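(* Let $p$ be an odd prime. Then $$n(p^{10},2)=7+X_{3,7}(p)\bigl(1+X_{36,73}(p)\bigr)+X_{5,17}(p)X_{12,17}(p)+X_{123,127}(p).$$
   Context: $\mathbb{N}=\{0,1,2,\dots\}$. A numerical semigroup is a subset $S\subset\mathbb{N}$ containing $0$, stable under addition and with finite complement in $\mathbb{N}$; its genus is $|\mathbb{N}\setminus S|$. For $g\ge 1$, $n(g,2)$ denotes the number of numerical semigroups $S$ of genus $g$ of the form $S=\langle a,b\rangle=\mathbb{N}a+\mathbb{N}b$ (two generators); semigroups are counted as sets. For an integer $a$ and a prime $q$, the function $X_{a,q}:\mathbb{Z}\to\{0,1\}$ is defined by $X_{a,q}(n)=1$ if $n\not\equiv a \pmod q$ and $X_{a,q}(n)=0$ if $n\equiv a\pmod q$. *)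

(* Defs.v *)
From mathcomp Require Import all_boot all_order all_algebra.
From mathcomp Require Import finmap.
From mathcomp Require Import mathcomp_extra boolp classical_sets functions cardinality.

Set Implicit Arguments.
Unset Strict Implicit.
Unset Printing Implicit Defensive.

Local Open Scope classical_set_scope.

Definition numerical_semigroup (S : set nat) : Prop :=
  [/\ S 0%N,
      (forall x y : nat, S x -> S y -> S (x + y)%N)
    & finite_set (~` S)].

(* [fset_set] sends infinite sets to [fset0], so [genus] is meaningful only
   for sets with finite complement. *)
Definition genus (S : set nat) : nat := #|` fset_set (~` S)|%fset.

(* The set <a, b> = N a + N b. *)
Definition gen2 (a b : nat) : set nat :=
  [set n | exists x y : nat, n = (x * a + y * b)%N].

Definition semigroups2 (g : nat) : set (set nat) :=
  [set S | [/\ numerical_semigroup S, genus S = g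
             & exists a b : nat, S = gen2 a b]].

(* n(g,2), a number of sets (not of generating pairs). [semigroups2 g] is
   finite for every g >= 1, the only case considered; for g = 0 it is {N}. *)
Definition n2 (g : nat) : nat := #|` fset_set (semigroups2 g)|%fset.

(* X_{a,q}(n), through the coercion of [bool] to [nat]. *)
Definition X (a : int) (q : nat) (n : int) : nat := (n != a %[mod q])%Z.

(* Main.v *)
Require Import Defs.
From mathcomp Require Import all_boot all_order all_algebra.
From mathcomp Require Import finmap boolp classical_sets cardinality zify ring.

Set Implicit Arguments.
Unset Strict Implicit.
Unset Printing Implicit Defensive.

Import GRing.Theory.

(** A cofinite semigroup with two generators has coprime generators [a] and
    [b], and Sylvester's formula gives its genus as (a-1)(b-1)/2.  Genus [p ^ e]
    therefore means (a-1)(b-1) = 2 p^e.  For [p] an odd prime exactly one of the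
    two factors is odd, so that up to order (a, b) = (p^k + 1, 2 p^(e-k) + 1)
    with k <= e; different [k] give different semigroups, because the unique
    even generator determines [k].  Hence n(p^e, 2) is the number of
    k <= e for which p^k + 1 and 2 p^(e-k) + 1 are coprime
    ([n2_prime_power]).

    For e = 10 the eleven coprimality conditions remain.  The
    polynomials x^k + 1 and 2 x^(10-k) + 1 generate an ideal of Z[x] containing a
    positive integer: 2, 1, 3, 7, 5, 1, 9, 127, 17, 511 = 7 * 73, 3 for
    k = 0, ..., 10.  Only the primes dividing this integer can be common
    divisors ([coprime_by_resultant]).
    The primes 2, 3 and 5 never are, since 2 p^10 + 1 is odd, -1 is not a
    square modulo 3 and not a fourth power modulo 5; this makes the seven
    values 0, 1, 2, 4, 5, 6, 10 of [k] contribute 1 each.  For the others the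
    common roots are 3 modulo 7 (k = 3), -4 = 123 modulo 127 (k = 7), 5 and 12
    modulo 17 (k = 8), and -1/2, that is 3 modulo 7 or 36 modulo 73 (k = 9).
    Adding the contributions of k = 3 and k = 9 gives the factor
    1 + X 36 73 p of X 3 7 p. *)

(** * Gaps and genus of <a, b> *)

Lemma inverse_mod_exists a b n : 0 < a -> coprime a b ->
  exists2 y, y < a & n = y * b %[mod a].
Proof.
move=> a0 cab; case: (posnP b) => [b0|b0].
  by move: cab; rewrite b0 /coprime gcdn0 => /eqP ->; exists 0; rewrite ?modn1.
have [u v uv _] := egcdnP a b0.
exists ((n * u) %% a); first by rewrite ltn_mod.
rewrite modnMml -mulnA uv gcdnC (eqP cab) mulnDr muln1 mulnA.
by rewrite modnMDl.
Qed.

(** The multiple [y * b] with y < a is the least element of <a, b> in its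
    residue class modulo [a]: the coefficient of [b] in any representation is
    congruent to [y], hence at least [y]. *)
Lemma gen2_residueP a b y n : 0 < a -> coprime a b -> y < a ->
  n = y * b %[mod a] -> gen2 a b n <-> y * b <= n.
Proof.
move=> a0 cab ya ny; split.
  case=> u [v nE]; have vy: v = y %[mod a].
    apply/eqP.
    have: v * b == y * b %[mod a] by rewrite -ny nE modnMDl.
    case: (leqP y v) => [yv|/ltnW vy].
      by rewrite (eqn_mod_dvd _ yv) eqn_mod_dvd ?leq_mul2r ?yv ?orbT //
           -mulnBl Gauss_dvdl.
    rewrite eq_sym [in X in _ -> X]eq_sym.
    by rewrite (eqn_mod_dvd _ vy) eqn_mod_dvd ?leq_mul2r ?vy ?orbT //
         -mulnBl Gauss_dvdl.
  rewrite nE (leq_trans _ (leq_addl _ _)) // leq_mul2r; apply/orP; right.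
  by rewrite -(modn_small ya) -vy leq_mod.
move=> ybn; have: n == y * b %[mod a] by apply/eqP.
rewrite (eqn_mod_dvd _ ybn) => /dvdnP[x xE].
by exists x, y; rewrite -xE subnK.
Qed.

(** Sylvester's symmetry around the Frobenius number F = ab - a - b: if [y] is
    the Apery index of [n], then a-1-y is that of F - n, and
    [F - n >= (a-1-y) b] amounts to [n <= y b - a], which given the congruence
    is the negation of [y b <= n]. *)
Lemma gen2_symmetric a b n : 0 < a -> 0 < b -> coprime a b ->
  n < a.-1 * b.-1 ->
  gen2 a b (a.-1 * b.-1 - n.+1) <-> ~ gen2 a b n.
Proof.
move=> a0 b0 cab nN; have [y ya ny] := inverse_mod_exists n a0 cab.
have y'a : a.-1 - y < a by lia.
have my : a.-1 * b.-1 - n.+1 = (a.-1 - y) * b %[mod a].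
  apply/eqP; rewrite -(eqn_modDr (n + a)); apply/eqP.
  have -> : a.-1 * b.-1 - n.+1 + (n + a) = a.-1 * b by nia.
  have -> : (a.-1 - y) * b + (n + a) = 1 * a + (n + (a.-1 - y) * b) by lia.
  rewrite modnMDl -modnDml ny modnDml.
  by congr (_ %% _); nia.
rewrite (gen2_residueP a0 cab y'a my) (gen2_residueP a0 cab ya ny).
have E : (a.-1 - y) * b + y * b = a.-1 * b by rewrite -mulnDl; congr (_ * _); lia.
have E2 : a.-1 * b = a.-1 * b.-1 + a.-1 by rewrite -{1}(prednK b0) mulnS addnC.
split=> [H|/negP]; first by apply/negP; lia.
rewrite -ltnNge => nlt.
have : n + a <= y * b.
  have: n == y * b %[mod a] by apply/eqP.
  rewrite eq_sym (eqn_mod_dvd _ (ltnW nlt)) => /dvdn_leq; lia.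
lia.
Qed.

(** Otherwise [n <= y b - a <= (a-1) b - a], which is the Frobenius number. *)
Lemma gen2_conductor a b n : 0 < a -> 0 < b -> coprime a b ->
  a.-1 * b.-1 <= n -> gen2 a b n.
Proof.
move=> a0 b0 cab Nn; have [y ya ny] := inverse_mod_exists n a0 cab.
apply/(gen2_residueP a0 cab ya ny); rewrite leqNgt; apply/negP => nlt.
have : n + a <= y * b.
  have: n == y * b %[mod a] by apply/eqP.
  rewrite eq_sym (eqn_mod_dvd _ (ltnW nlt)) => /dvdn_leq; lia.
have : y * b <= a.-1 * b by rewrite leq_mul2r; apply/orP; right; lia.
have E2 : a.-1 * b = a.-1 * b.-1 + a.-1 by rewrite -{1}(prednK b0) mulnS addnC.
lia.
Qed.

Lemma mem_fset_seq (s : seq nat) x : (x \in [fset y in s]%fset) = (x \in s).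
Proof. by rewrite inE. Qed.

Lemma gaps_gen2E a b : 0 < a -> 0 < b -> coprime a b ->
  (~` gen2 a b)%classic =
  [set` [fset n in [seq n <- index_iota 0 (a.-1 * b.-1)
                   | ~~ `[< gen2 a b n >]]]%fset]%classic.
Proof.
move=> a0 b0 cab; apply/seteqP; split=> n /=; rewrite !inE mem_filter mem_index_iota.
  move=> nS; apply/andP; split; first by apply/asboolPn.
  by rewrite /= ltnNge; apply/negP => /(gen2_conductor a0 b0 cab).
by case/andP => /asboolPn.
Qed.

(** The symmetry pairs the gaps below (a-1)(b-1) with the non-gaps, so the gaps
    are half of this interval. *)
Lemma genus_gen2 a b : 0 < a -> 0 < b -> coprime a b ->
  (genus (gen2 a b)).*2 = a.-1 * b.-1.
Proof.
move=> a0 b0 cab; rewrite /genus gaps_gen2E // set_fsetK card_fseq.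
rewrite undup_id ?filter_uniq ?iota_uniq // size_filter -sum1_count.
set N := a.-1 * b.-1.
(* One of the two copies of the count is reversed by n |-> N - 1 - n. *)
rewrite big_mkcond big_mkord -addnn.
rewrite {1}(reindex_inj rev_ord_inj) -big_split /=.
rewrite -[RHS]card_ord -sum1_card; apply: eq_bigr => i _.
case: asboolP; rewrite gen2_symmetric //; case: asboolP => //; tauto.
Qed.

(** * Cofinite semigroups with two generators *)

Lemma numerical_semigroup_gen2 a b : 0 < a -> 0 < b -> coprime a b ->
  numerical_semigroup (gen2 a b).
Proof.
move=> a0 b0 cab; split.
- by exists 0, 0.
- move=> _ _ [x [y ->]] [z [t ->]]; exists (x + z), (y + t); lia.
- by rewrite gaps_gen2E //; apply: finite_fset.
Qed.

(** A cofinite set contains two consecutive integers, both divisible by the gcd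
    of the generators. *)
Lemma coprime_gen2 a b : finite_set (~` gen2 a b)%classic -> coprime a b.
Proof.
move=> fS.
have [N hN] : exists N, forall n, N <= n -> gen2 a b n.
  exists (\max_(i <- fset_set (~` gen2 a b)%classic) i).+1 => n Nn.
  apply: contrapT => nS; suff : n <= \max_(i <- fset_set (~` gen2 a b)%classic) i.
    by rewrite leqNgt Nn.
  by apply: leq_bigmax_seq => //; rewrite in_fset_set // inE.
have dvdS n : gen2 a b n -> gcdn a b %| n.
  by case=> x [y ->]; rewrite dvdn_add // dvdn_mull // ?dvdn_gcdl ?dvdn_gcdr.
have := dvdS _ (hN N.+1 (leqnSn _)).
by rewrite -addn1 (dvdn_addr _ (dvdS _ (hN N (leqnn N)))) dvdn1.
Qed.

Lemma gen2C a b : gen2 a b = gen2 b a.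
Proof.
by apply/seteqP; split=> n [x [y ->]]; exists y, x; rewrite addnC.
Qed.

(** A generator [a] is not a sum of two nonzero elements of <a, b>: both would be
    smaller than [a], hence multiples of [b], and [b] would divide [a].  So a
    representation of [a] by other generators [c], [d] is one of them. *)
Lemma gen2_atom a b c d : 0 < a -> 1 < b -> coprime a b ->
  gen2 a b = gen2 c d -> a = c \/ a = d.
Proof.
move=> a0 b1 cab Scd.
have small u : gen2 a b u -> u < a -> b %| u.
  case=> x [y ->]; case: x => [|x]; first by rewrite add0n dvdn_mull.
  by rewrite mulSn; lia.
have split_a u v : gen2 a b u -> gen2 a b v -> a = u + v -> u = 0 \/ v = 0.
  move=> Su Sv aE; case: (posnP u) => [->|u0]; first by left.
  case: (posnP v) => [->|v0]; first by right.
  have ba : b %| a by rewrite aE dvdn_add ?small //; lia.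
  by move: cab; rewrite coprime_sym /coprime (gcdn_idPl ba); lia.
have [x [y aE]] : gen2 c d a by rewrite -Scd; exists 1, 0; lia.
have Sm i j : gen2 a b (i * c + j * d) by rewrite Scd; exists i, j.
case: x aE => [|x] aE.
  case: y aE => [|y] aE; first by lia.
  right; have := split_a _ _ (Sm 0 1) (Sm 0 y); nia.
case: (split_a _ _ (Sm 1 0) (Sm x y)); first by lia.
  rewrite mul1n mul0n addn0 => c0; right; case: y aE => [|y] aE; first by nia.
  by case: (split_a _ _ (Sm 0 1) (Sm 0 y)); nia.
by move=> H; left; nia.
Qed.

(** <0, 1> is all of N; presenting it by positive generators disposes of the
    pairs with a zero generator. *)
Lemma gen2_01 : gen2 0 1 = gen2 1 1.
Proof.
apply/seteqP; split=> n [x [y ->]]; first by exists 0, y; lia.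
by exists 0, (x + y); lia.
Qed.

Lemma cofinite_gen2_pos a b : finite_set (~` gen2 a b)%classic ->
  exists c d, [/\ 0 < c, 0 < d, coprime c d & gen2 a b = gen2 c d].
Proof.
move=> /coprime_gen2 cab.
have [a0|a0] := posnP a.
  move: cab; rewrite a0 /coprime gcd0n => /eqP ->.
  by exists 1, 1; split=> //; apply: gen2_01.
have [b0|b0] := posnP b; last by exists a, b.
move: cab; rewrite b0 /coprime gcdn0 => /eqP ->.
by exists 1, 1; split=> //; rewrite gen2C; apply: gen2_01.
Qed.

(** * Semigroups of genus p ^ e *)

Lemma factor_double_prime_power p e a b : prime p -> odd p -> odd a ->
  a * b = (p ^ e).*2 -> exists2 k, k <= e & a = p ^ k /\ b = (p ^ (e - k)).*2.
Proof.
move=> pp po ao abE.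
have b2 : ~~ odd b by move: (congr1 odd abE); rewrite oddM ao odd_double /= => ->.
have bE : b = b./2.*2 by rewrite even_halfK.
have abE' : a * b./2 = p ^ e by apply: double_inj; rewrite -abE {2}bE -!muln2 mulnA.
have : a %| p ^ e by rewrite -abE' dvdn_mulr.
case/(dvdn_pfactor _ _ pp) => k ke aE; exists k => //; split=> //.
rewrite bE; congr _.*2; apply/eqP.
have pk0 : 0 < p ^ k by rewrite expn_gt0 prime_gt0.
by rewrite -(eqn_pmul2l pk0) -{1}aE abE' -expnD subnKC.
Qed.

Lemma semigroups2_prime_powerE p e : prime p -> odd p ->
  semigroups2 (p ^ e) =
  [set` ((fun k => gen2 (p ^ k).+1 (p ^ (e - k)).*2.+1) @`
         [fset k in [seq k <- index_iota 0 e.+1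
                    | coprime (p ^ k).+1 (p ^ (e - k)).*2.+1]])%fset]%classic.
Proof.
move=> pp po; have p0 k : 0 < p ^ k by rewrite expn_gt0 prime_gt0.
apply/seteqP; split=> S.
  case=> [[_ _ fS] gS [a' [b' SE]]]; rewrite {}SE in fS gS *.
  have [a [b [a0 b0 cab SE]]] := cofinite_gen2_pos fS.
  rewrite {}SE {fS} in gS *.
  have := genus_gen2 a0 b0 cab; rewrite gS => /esym.
  wlog ao : a b cab a0 b0 gS / odd a.-1 => [H abE|abE].
    have [ao|an] := boolP (odd a.-1); first exact: H.
    have [bo|bn] := boolP (odd b.-1).
      by rewrite gen2C; apply: H; rewrite // 1?coprime_sym // 1?gen2C // mulnC.
    (* Two even factors would make 4 divide twice an odd number. *)
    exfalso.
    have : 4 %| (p ^ e).*2.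
      by rewrite -abE -[4]/(2 * 2) dvdn_mul // dvdn2.
    by rewrite -muln2 -[4]/(2 * 2) dvdn_pmul2r // dvdn2 oddX po orbT.
  have [k ke [aE bE]] := factor_double_prime_power pp po ao abE.
  apply/imfsetP; exists k.
    by rewrite mem_fset_seq mem_filter mem_index_iota /= -aE -bE !prednK // cab ltnS.
  by rewrite -aE -bE !prednK.
case/imfsetP => k; rewrite mem_fset_seq mem_filter mem_index_iota => /andP[cab /= ke] ->.
split; last by eexists; eexists.
  exact: numerical_semigroup_gen2.
by apply: double_inj; rewrite genus_gen2 //= -doubleMr -expnD subnKC.
Qed.

Lemma n2_prime_power p e : prime p -> odd p ->
  n2 (p ^ e) = \sum_(k < e.+1) coprime (p ^ k).+1 (p ^ (e - k)).*2.+1.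
Proof.
move=> pp po; have p0 k : 0 < p ^ k by rewrite expn_gt0 prime_gt0.
rewrite /n2 semigroups2_prime_powerE // set_fsetK.
rewrite (eqP (introT (card_in_imfsetP _ _) _)); last first.
  (* The generators p^k + 1 are even and the other ones odd. *)
  move=> j k; rewrite !mem_fset_seq !mem_filter => /andP[cj _] /andP[ck _] E.
  have [] := gen2_atom _ _ cj E; rewrite ?ltnS ?double_gt0 //.
    by case=> /eqP; rewrite eqn_exp2l ?prime_gt1 // => /eqP.
  by case=> /(congr1 odd); rewrite odd_double oddX po orbT.
rewrite card_fseq undup_id ?filter_uniq ?iota_uniq // size_filter -sum1_count.
by rewrite big_mkcond big_mkord; apply: eq_bigr => k _; case: coprime.
Qed.

(** * Common divisors of x^j + 1 and 2 x^k + 1 *)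

Local Open Scope ring_scope.

Lemma dvdz_lincomb (d m n r u v w : int) :
  (d %| m)%Z -> (d %| n)%Z -> r = u * m + v * n + w * d -> (d %| r)%Z.
Proof. by move=> dm dn ->; rewrite !rpredD // dvdz_mull. Qed.

(** A common prime factor divides every integer in the ideal generated by the two
    numbers, so testing the prime factors of one such integer [c] is enough. *)
Lemma coprime_by_resultant x j k c (u v : int) : (0 < c)%N ->
  (u * (x%:Z ^+ j + 1) + v * (2 * x%:Z ^+ k + 1) = c%:Z)%R ->
  coprime (x ^ j).+1 (x ^ k).*2.+1 =
  all (fun q : nat => ~~ ((q%:Z %| x%:Z ^+ j + 1)%Z &&
                          (q%:Z %| 2 * x%:Z ^+ k + 1)%Z)) (primes c).
Proof.
move=> c0 uvc.
have mE : (x%:Z ^+ j + 1 = (x ^ j)%N.+1%:Z)%R by rewrite -natz -natrX natz; lia.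
have nE : (2 * x%:Z ^+ k + 1 = (x ^ k)%N.*2.+1%:Z)%R by rewrite -natz -natrX natz; lia.
rewrite mE nE in uvc *; apply/idP/allP => [cmn q|nodiv].
  rewrite mem_primes => /and3P[q_pr _ _]; apply/negP => /andP[qm qn].
  have : (q %| gcdn (x ^ j).+1 (x ^ k).*2.+1)%N by rewrite dvdn_gcd; apply/andP.
  by rewrite (eqP cmn) dvdn1 => /eqP q1; rewrite q1 in q_pr.
apply: contraT => ncop; set g := gcdn (x ^ j).+1 (x ^ k).*2.+1.
have g1 : (1 < g)%N by rewrite ltn_neqAle eq_sym ncop gcdn_gt0.
have gm : (pdiv g %| (x ^ j).+1)%N by apply: dvdn_trans (pdiv_dvd g) (dvdn_gcdl _ _).
have gn : (pdiv g %| (x ^ k).*2.+1)%N by apply: dvdn_trans (pdiv_dvd g) (dvdn_gcdr _ _).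
have /nodiv : pdiv g \in primes c.
  rewrite mem_primes pdiv_prime // c0 /=.
  have : ((pdiv g)%:Z %| c%:Z)%Z by rewrite -uvc rpredD // dvdz_mull.
  by [].
by rewrite negb_and => /orP[/negP|/negP]; case.
Qed.

(** * The eleven factorizations for exponent 10 *)

Lemma coprime_shifted_pow_0_10 (x : nat) : coprime (x ^ 0).+1 (x ^ 10).*2.+1.
Proof. by rewrite expn0 coprime2n /= odd_double. Qed.

(** This Bezout certificate and the following ones come from the Euclidean
    algorithm on x^j + 1 and 2 x^(10-j) + 1, with denominators cleared. *)
Lemma coprime_shifted_pow_1_9 (x : nat) : coprime (x ^ 1).+1 (x ^ 9).*2.+1.
Proof.
rewrite (@coprime_by_resultant x 1 9 1
  (2 * (x%:Z ^+ 8 - x%:Z ^+ 7 + x%:Z ^+ 6 - x%:Z ^+ 5 + x%:Z ^+ 4 - x%:Z ^+ 3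
        + x%:Z ^+ 2 - x%:Z + 1)) (-1)) //.
by ring.
Qed.

Lemma coprime_shifted_pow_5_5 (x : nat) : coprime (x ^ 5).+1 (x ^ 5).*2.+1.
Proof. by rewrite (@coprime_by_resultant x 5 5 1 2 (-1)) //; ring. Qed.

Lemma dvdz_exprD1_mod (q y : int) k :
  (q %| y ^+ k + 1)%Z = (q %| (y %% q)%Z ^+ k + 1)%Z.
Proof.
have E : (y ^+ k + 1 = (y %% q)%Z ^+ k + 1 %[mod q])%Z.
  by rewrite -[RHS]modzDml modzXm modzDml.
by apply/dvdz_mod0P/dvdz_mod0P; rewrite E.
Qed.

Lemma ndvdz_sqrD1_3 (y : int) : (3 %| y ^+ 2 + 1)%Z = false.
Proof.
rewrite dvdz_exprD1_mod.
have := ltz_pmod y (isT : 0 < 3%:Z); have := modz_ge0 y (isT : 3%:Z != 0).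
by case: (y %% 3)%Z => [[|[|[|r]]]|r].
Qed.

Lemma ndvdz_expr4D1_5 (y : int) : (5 %| y ^+ 4 + 1)%Z = false.
Proof.
rewrite dvdz_exprD1_mod.
have := ltz_pmod y (isT : 0 < 5%:Z); have := modz_ge0 y (isT : 5%:Z != 0).
by case: (y %% 5)%Z => [[|[|[|[|[|r]]]]]|r].
Qed.

Lemma coprime_shifted_pow_2_8 (x : nat) : coprime (x ^ 2).+1 (x ^ 8).*2.+1.
Proof.
rewrite (@coprime_by_resultant x 2 8 3
  (-2 * (x%:Z ^+ 2 - 1) * (x%:Z ^+ 4 + 1)) 1) //=; last by ring.
by rewrite ndvdz_sqrD1_3.
Qed.

Lemma coprime_shifted_pow_4_6 (x : nat) : coprime (x ^ 4).+1 (x ^ 6).*2.+1.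
Proof.
rewrite (@coprime_by_resultant x 4 6 5
  (4 - 2 * x%:Z ^+ 2 * (1 + 2 * x%:Z ^+ 2)) (1 + 2 * x%:Z ^+ 2)) //=; last by ring.
by rewrite ndvdz_expr4D1_5.
Qed.

Lemma coprime_shifted_pow_6_4 (x : nat) : coprime (x ^ 6).+1 (x ^ 4).*2.+1.
Proof.
rewrite (@coprime_by_resultant x 6 4 9
  (4 * (x%:Z ^+ 2 + 2)) (1 - 2 * x%:Z ^+ 2 * (x%:Z ^+ 2 + 2))) //=; last by ring.
by rewrite -[6%N]/(3 * 2)%N exprM ndvdz_sqrD1_3.
Qed.

Lemma coprime_shifted_pow_10_0 (x : nat) : coprime (x ^ 10).+1 (x ^ 0).*2.+1.
Proof.
rewrite (@coprime_by_resultant x 10 0 3 0 1) //.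
by rewrite /= -[10%N]/(5 * 2)%N exprM ndvdz_sqrD1_3.
Qed.

(** Modulo x^3 + 1 the second number is 2x + 1, whose root -1/2 satisfies
    8 (x^3 + 1) = 7. *)
Lemma coprime_shifted_pow_3_7 (x : nat) :
  coprime (x ^ 3).+1 (x ^ 7).*2.+1 = X 3 7 x :> nat.
Proof.
rewrite (@coprime_by_resultant x 3 7 7
  (* the quotient 4x^2 - 2x + 1 is that of 8x^3 + 1 by 2x + 1 *)
  (8 + (4 * x%:Z ^+ 2 - 2 * x%:Z + 1) * 2 * x%:Z * (x%:Z ^+ 3 - 1))
  (- (4 * x%:Z ^+ 2 - 2 * x%:Z + 1))) //=; last by ring.
rewrite andbT /X eqz_mod_dvd; congr (nat_of_bool (~~ _)).
set y := x%:Z; apply/andP/idP => [[qm qn]|ql].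
  apply: (@dvdz_lincomb _ _ _ _ (-8 * y * (y ^+ 3 - 1)) 4 (- y - 1) qm qn).
  by ring.
have qw : (7 %| 2 * y + 1)%Z by apply: (@dvdz_lincomb _ _ _ _ 2 0 1 ql ql); ring.
have qm : (7 %| y ^+ 3 + 1)%Z.
  by apply: (@dvdz_lincomb _ _ _ _ (4 * y ^+ 2 - 2 * y + 1) 0 (- y ^+ 3) qw qw); ring.
split=> //.
by apply: (@dvdz_lincomb _ _ _ _ 1 (2 * y * (y ^+ 3 - 1)) 0 qw qm); ring.
Qed.

(** 4 (x^7 + 1) is x + 4 modulo 2x^3 + 1, and 2 (-4)^3 + 1 = -127. *)
Lemma coprime_shifted_pow_7_3 (x : nat) :
  coprime (x ^ 7).+1 (x ^ 3).*2.+1 = X 123 127 x :> nat.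
Proof.
set y := x%:Z.
rewrite (@coprime_by_resultant x 7 3 127
  (8 * (y ^+ 2 - 4 * y + 16))
  (- 2 * (y ^+ 2 - 4 * y + 16) * y * (2 * y ^+ 3 - 1) - 1)) //=; last by ring.
rewrite andbT /X eqz_mod_dvd -/y; congr (nat_of_bool (~~ _)).
apply/andP/idP => [[qm qn]|ql].
  by apply: (@dvdz_lincomb _ _ _ _ 4 (- y * (2 * y ^+ 3 - 1)) (-1) qm qn); ring.
have qw : (127 %| y + 4)%Z by apply: (@dvdz_lincomb _ _ _ _ 1 0 1 ql ql); ring.
have qn : (127 %| 2 * y ^+ 3 + 1)%Z.
  by apply: (@dvdz_lincomb _ _ _ _ (2 * (y ^+ 2 - 4 * y + 16)) 0 (-1) qw qw); ring.
split=> //.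
apply: (@dvdz_lincomb _ _ _ _ 32 (32 * y * (2 * y ^+ 3 - 1)) (- (y ^+ 7 + 1)) qw qn).
by ring.
Qed.

(** 16 (x^8 + 1) is 17 modulo 2x^2 + 1, and modulo 17 the latter is
    2 (x - 5)(x - 12). *)
Lemma coprime_shifted_pow_8_2 (x : nat) :
  coprime (x ^ 8).+1 (x ^ 2).*2.+1 = (X 5 17 x * X 12 17 x)%N :> nat.
Proof.
set y := x%:Z.
rewrite (@coprime_by_resultant x 8 2 17 16
  (- (2 * y ^+ 2 - 1) * (4 * y ^+ 4 + 1))) //=; last by ring.
rewrite andbT /X !eqz_mod_dvd -/y mulnb -negb_or; congr (nat_of_bool (~~ _)).
have -> : (17 %| y - 5)%Z || (17 %| y - 12)%Z = (17 %| (y - 5) * (y - 12))%Z.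
  by rewrite !dvdzE abszM Euclid_dvdM.
apply/andP/idP => [[qm qn]|ql].
  by apply: (@dvdz_lincomb _ _ _ _ 0 9 (- y ^+ 2 - y + 3) qm qn); ring.
have qn : (17 %| 2 * y ^+ 2 + 1)%Z.
  by apply: (@dvdz_lincomb _ _ _ _ 2 0 (2 * y - 7) ql ql); ring.
split=> //.
apply: (@dvdz_lincomb _ _ _ _ (- (2 * y ^+ 2 - 1) * (4 * y ^+ 4 + 1)) 0 (y ^+ 8) qn qn).
by ring.
Qed.

(** 512 (x^9 + 1) is 511 = 7 * 73 modulo 2x + 1, whose root -1/2 is 3 modulo 7
    and 36 modulo 73. *)
Lemma coprime_shifted_pow_9_1 (x : nat) :
  coprime (x ^ 9).+1 (x ^ 1).*2.+1 = (X 3 7 x * X 36 73 x)%N :> nat.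
Proof.
set y := x%:Z.
(* s is the quotient of 512 x^9 + 1 by 2x + 1. *)
pose s := 256 * y ^+ 8 - 128 * y ^+ 7 + 64 * y ^+ 6 - 32 * y ^+ 5
          + 16 * y ^+ 4 - 8 * y ^+ 3 + 4 * y ^+ 2 - 2 * y + 1.
have res511 : 512 * (y ^+ 9 + 1) + - s * (2 * y ^+ 1 + 1) = 511%N%:Z.
  by rewrite /s; ring.
rewrite (coprime_by_resultant (isT : (0 < 511)%N) res511).
have -> : primes 511 = [:: 7; 73]%N by vm_compute.
rewrite /= andbT /X !eqz_mod_dvd -/y mulnb; congr (nat_of_bool (~~ _ && ~~ _)).
  apply/andP/idP => [[qm qn]|ql].
    by apply: (@dvdz_lincomb _ _ _ _ 0 4 (- y - 1) qm qn); ring.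
  have qn : (7 %| 2 * y ^+ 1 + 1)%Z.
    by apply: (@dvdz_lincomb _ _ _ _ 2 0 1 ql ql); ring.
  split=> //.
  apply: (@dvdz_lincomb _ _ _ _ s 0 (73 - 73 * (y ^+ 9 + 1)) qn qn).
  by rewrite /s; ring.
apply/andP/idP => [[qm qn]|ql].
  by apply: (@dvdz_lincomb _ _ _ _ 0 37 (- y - 1) qm qn); ring.
have qn : (73 %| 2 * y ^+ 1 + 1)%Z.
  by apply: (@dvdz_lincomb _ _ _ _ 2 0 1 ql ql); ring.
split=> //.
apply: (@dvdz_lincomb _ _ _ _ s 0 (7 - 7 * (y ^+ 9 + 1)) qn qn).
by rewrite /s; ring.
Qed.

Local Close Scope ring_scope.

Theorem theorem6p3 (p : nat) (hp : prime p) (hodd : odd p) :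
  n2 (p ^ 10) = 7 + X 3 7 p * (1 + X 36 73 p) + X 5 17 p * X 12 17 p
                + X 123 127 p.
Proof.
rewrite n2_prime_power // !big_ord_recl big_ord0 /=.
rewrite !(coprime_shifted_pow_0_10, coprime_shifted_pow_1_9,
  coprime_shifted_pow_2_8, coprime_shifted_pow_4_6, coprime_shifted_pow_5_5,
  coprime_shifted_pow_6_4, coprime_shifted_pow_10_0).
rewrite coprime_shifted_pow_3_7 coprime_shifted_pow_7_3.
rewrite coprime_shifted_pow_8_2 coprime_shifted_pow_9_1.
lia.
Qed.
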